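(* There exist a constant $\gamma \geq 0.002$ and a number $n_0$ such that for every integer $n > n_0$, $$S(n) < n^{1/2} + n^{1/4}(1-\gamma),$$ where $S(n)$ denotes the maximum cardinality of a Sidon set $A \subseteq \{1,2,\dots,n\}$.
   Context: A set of integers $A$ is a Sidon set if whenever $a+b=c+d$ with $a,b,c,d\in A$, then $\{a,b\}=\{c,d\}$ (i.e., all sums $a+b$ with $a,b\in A$ are distinct up to reordering of the summands). For a positive integer $n$, $S(n)$ is the maximum size of a Sidon set contained in $[n]=\{1,2,\dots,n\}$. *)

(* Defs.v *)
From HB Require Import structures.
From mathcomp Require Export all_boot all_order all_algebra finmap.
From mathcomp Require Export all_classical all_reals all_analysis.

Set Implicit Arguments.
Unset Strict Implicit.
Unset Printing Implicit Defensive.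

Import GRing.Theory.
Local Open Scope classical_set_scope.
Local Open Scope ring_scope.

Definition is_sidon (A : set int) : Prop :=
  forall a b c d : int, A a -> A b -> A c -> A d ->
    a + b = c + d -> [set a; b] = [set c; d].

Definition interval1 (n : nat) : {fset int} :=
  [fset (Posz k) | k in iota 1 n]%fset.

Definition sidon_max (n : nat) : nat :=
  (\max_(A <- fpowerset (interval1 n) | `[< is_sidon [set` A] >]) #|` A|)%N.

Lemma mem_interval1 (n : nat) (x : int) :
  (x \in interval1 n) = (1 <= x <= n%:Z).
Proof.
apply/idP/idP => [/imfsetP[k /=]|].
  by rewrite mem_iota add1n ltnS => /andP[k1 kn] ->; rewrite !lez_nat k1 kn.
case: x => // k; rewrite !lez_nat => k1n; apply/imfsetP; exists k => //=.
by rewrite mem_iota add1n ltnS.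
Qed.

Lemma sidon_max_ub (n : nat) (A : {fset int}) :
  (A `<=` interval1 n)%fset -> is_sidon [set` A] ->
  (#|` A| <= sidon_max n)%N.
Proof.
move=> An As; rewrite /sidon_max.
apply: (@leq_bigmax_seq _ _ _ (fun A : {fset int} => #|` A|)).
  by rewrite fpowersetE.
exact/asboolP.
Qed.

Lemma sidon_max_attained (n : nat) :
  exists A : {fset int}, [/\ (A `<=` interval1 n)%fset, is_sidon [set` A]
    & #|` A| = sidon_max n].
Proof.
rewrite /sidon_max big_seq_cond.
elim/big_rec: _ => [|B m /andP[+ /asboolP sB] [C [Cn sC <-]]].
  exists fset0; split; [exact: fsub0set|by move=> a b c d; rewrite /= inE|].
  exact: cardfs0.
rewrite fpowersetE => Bn.
by rewrite /maxn; case: ifP => _; [exists C | exists B].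
Qed.

(* Main.v *)
Require Import Defs.
From mathcomp Require Import zify ring lra.
Import Order.TTheory GRing.Theory Num.Theory.
Local Open Scope ring_scope.

(** Let [k = |A|] and let [A_u(i)] be the number of elements of [A] in the window
    of length [u] starting at [i].  As every positive difference occurs at most
    once, [sum_i A_u(i)^2] is [u k + u (u - 1)] minus a nonnegative term [2 F(u)]
    counting missing differences, with [F] superadditive.  This makes the
    variance of [A_u] around its mean explicit: for [u = s n^(3/4)] and
    [k = n^(1/2) + t n^(1/4)] it is [s (1 + s^2 - 2 t s) n^(5/4) - 2 F(u)] up to
    lower order terms.  For [t] close to 1 this almost vanishes at [s = 1] (which
    is the Erdos-Turan bound [t <= 1]), forcing [F] to be small as well, so that
    the variance at [s] is close to [s (1 - s)^2].  But a window with [s = 1/4] is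
    the difference of windows with [s = 1] and [s = 3/4], so the variance at
    [1/4], about [9/64], is at most twice the sum of those at [1] and [3/4],
    about [6/64]; this is absurd.  Keeping track of [t] gives
    [t <= 389/392 + o(1)]. *)

(** * Translation of finite sums *)

Section ShiftedSums.
Variable R : realFieldType.
Implicit Types (g : nat -> R) (T j : nat).

Lemma sum_shift_le g T j : (forall x, 0 <= g x) ->
  (forall x, (T <= x)%N -> g x = 0) ->
  \sum_(i < T) g (i + j)%N <= \sum_(x < T) g x.
Proof.
move=> g0 gT; elim: j => [|j IH].
  by rewrite le_eqVlt; apply/orP; left; apply/eqP/eq_bigr => i _; rewrite addn0.
apply: le_trans IH; case: T gT => [|T] gT; first by rewrite !big_ord0.
rewrite big_ord_recr [leRHS]big_ord_recl /= gT ?addr0; last by lia.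
rewrite -[leLHS]add0r lerD ?g0 //.
by apply: ler_sum => i _; rewrite /bump /= addnS add1n addSn.
Qed.

Lemma sum_shift g T j : (forall x, (x < j)%N -> g x = 0) ->
  (forall x, (T <= x)%N -> g x = 0) ->
  \sum_(i < T) g (i + j)%N = \sum_(x < T) g x.
Proof.
move=> gj gT; elim: j gj => [|j IH] gj.
  by apply: eq_bigr => i _; rewrite addn0.
rewrite -IH; last by move=> x xj; apply: gj; lia.
case: T gT IH => [|T] gT IH; first by rewrite !big_ord0.
rewrite big_ord_recr [RHS]big_ord_recl /= gT ?addr0; last by lia.
rewrite gj ?add0r; last by lia.
by apply: eq_bigr => i _; rewrite /bump /= addnS add1n addSn.
Qed.

End ShiftedSums.

(** * Window counts of a set with distinct differences, and their variance *)

Section Windows.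
(** The set is shifted to start at [m], so that every window of length at most [m] meeting the
    interval starts at a natural number below [T]. *)
Variables (R : realFieldType) (m n : nat) (a : pred nat) (c : R).
Hypothesis supp : forall x, a x -> (m <= x < m + n)%N.
Hypothesis diff_inj : forall d x y, (0 < d)%N ->
  a x -> a (x + d)%N -> a y -> a (y + d)%N -> x = y.

Let T := (m + n)%N.
Let f x : R := (a x)%:R.

Let f0l x : (x < m)%N -> f x = 0.
Proof. by rewrite /f; case: (boolP (a x)) => // /supp; lia. Qed.

Let f0r x : (T <= x)%N -> f x = 0.
Proof. by rewrite /f; case: (boolP (a x)) => // /supp; rewrite /T; lia. Qed.

Definition window_count u i : R := \sum_(j < u) f (i + j)%N.
Definition population : R := \sum_(x < T) f x.
Definition missing d : R := 1 - \sum_(x < T) f x * f (x + d)%N.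
(** This is [F(u)] of the overview: the difference [d] gets weight [u - d], the number of windows of
    length [u] that contain a given pair at distance [d]. *)
Definition cum_missing u : R := \sum_(v < u) \sum_(d < v) missing d.+1.

Lemma window_countD u v i :
  window_count (u + v) i = window_count u i + window_count v (i + u).
Proof.
rewrite /window_count big_split_ord /=; congr (_ + _).
by apply: eq_bigr => j _; rewrite addnA.
Qed.

Lemma missing_ge0 d : (0 < d)%N -> 0 <= missing d.
Proof.
move=> d0; rewrite subr_ge0.
have [/existsP[x /andP[ax axd]]|] :=
    boolP [exists x : 'I_T, a x && a (x + d)%N].
  rewrite (bigD1 x) //= big1 ?addr0; first by rewrite /f ax axd mulr1.
  move=> y yx; rewrite /f; case: (boolP (a y)) => ay; last by rewrite mul0r.
  case: (boolP (a (y + d)%N)) => ayd; last by rewrite mulr0.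
  by case/eqP: yx; apply: val_inj; apply: (diff_inj d).
rewrite negb_exists => /forallP nx; rewrite big1 // => x _.
rewrite /f.
by have := nx x; rewrite negb_and => /orP[] /negbTE ->; rewrite ?mul0r ?mulr0.
Qed.

Lemma sum_missing_homo u v : (u <= v)%N ->
  \sum_(d < u) missing d.+1 <= \sum_(d < v) missing d.+1.
Proof.
move=> /subnKC <-; rewrite big_split_ord /= lerDl sumr_ge0 // => i _.
exact: missing_ge0.
Qed.

Lemma cum_missing_ge0 u : 0 <= cum_missing u.
Proof.
by apply: sumr_ge0 => v _; apply: sumr_ge0 => d _; apply: missing_ge0.
Qed.

(** The inner sums grow with their length, so the last [v] of them dominate the first [v]. *)
Lemma cum_missing_superadd u v :
  cum_missing u + cum_missing v <= cum_missing (u + v).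
Proof.
rewrite /cum_missing big_split_ord /= lerD2l.
by apply: ler_sum => i _; apply: sum_missing_homo; rewrite leq_addl.
Qed.

Lemma sum_window_count u : (u <= m)%N ->
  \sum_(i < T) window_count u i = u%:R * population.
Proof.
move=> um; rewrite exchange_big /= (eq_bigr (fun=> population)).
  by rewrite sumr_const card_ord mulr_natl.
move=> j _; apply: sum_shift => // x xj; apply: f0l.
by have := ltn_ord j; lia.
Qed.

(* Passing from [u] to [u.+1] adds the pairs at distance at most [u]. *)
Lemma sum_window_count_sqr u : (u <= m)%N ->
  \sum_(i < T) window_count u i ^+ 2 =
  u%:R * population + u%:R ^+ 2 - u%:R - 2 * cum_missing u.
Proof.
elim: u => [|u IH] um.
  rewrite /cum_missing big_ord0 big1; first by ring.
  by move=> i _; rewrite /window_count big_ord0 expr0n.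
have step i : window_count u.+1 i ^+ 2 = window_count u i ^+ 2 +
    2 * (\sum_(j < u) f (i + j)%N * f (i + u)%N) + f (i + u)%N.
  rewrite -mulr_suml /window_count big_ord_recr /=.
  have ff : f (i + u)%N ^+ 2 = f (i + u)%N.
    by rewrite /f; case: (a _); rewrite ?expr1n ?expr0n.
  by rewrite sqrrD ff; ring.
under eq_bigr do rewrite step.
rewrite !big_split /= -mulr_sumr.
rewrite IH; last by lia.
rewrite exchange_big /=.
have -> : \sum_(i < T) f (i + u)%N = population.
  by apply: sum_shift => // x xu; apply: f0l; lia.
have -> : \sum_(j < u) \sum_(i < T) f (i + j)%N * f (i + u)%N =
    u%:R - \sum_(d < u) missing d.+1.
  (* Counting [j] from the right end makes [j.+1] the distance between the two points. *)
  rewrite (reindex_inj rev_ord_inj) /=.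
  have -> : u%:R = \sum_(d < u) (1 : R) by rewrite sumr_const card_ord.
  rewrite -sumrB; apply: eq_bigr => j _; have ju := ltn_ord j.
  rewrite /missing opprB addrCA subrr addr0.
  rewrite -(@sum_shift R (fun x => f x * f (x + j.+1)%N) T (u - j.+1)%N).
  - by apply: eq_bigr => i _; congr (_ * f _); lia.
  - by move=> x xu; rewrite f0l ?mul0r //; lia.
  - by move=> x xT; rewrite f0r ?mul0r.
rewrite /cum_missing big_ord_recr /= -[u.+1]addn1 natrD.
ring.
Qed.

(** The last point [i + u - 1] is at least [m]; at the other end, [i < T] is ensured by the range of
    summation. *)
Definition meets u i := (m < i + u)%N.
Definition deviation u i : R := window_count u i - c * u%:R.
Definition variance u : R := \sum_(i < T | meets u i) deviation u i ^+ 2.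

Lemma sum_meets u : (0 < u <= m)%N ->
  \sum_(i < T) (meets u i)%:R = n%:R + u%:R - 1 :> R.
Proof.
case/andP=> u0 um.
have -> : T = (m - u).+1 + (n + u).-1 :> nat by rewrite /T; lia.
rewrite big_split_ord /= big1 ?add0r.
  rewrite (eq_bigr (fun=> 1)); first last.
    by move=> i _; rewrite /meets; case: ltnP => //; lia.
  by rewrite sumr_const card_ord -subn1 natrB ?natrD //; lia.
by move=> i _; rewrite /meets; case: ltnP => //; have := ltn_ord i; lia.
Qed.

(** The value of [variance u] when every positive difference below [u] occurs. *)
Definition variance_bound u : R :=
  u%:R * population - 2 * c * u%:R ^+ 2 * population
  + c ^+ 2 * u%:R ^+ 2 * (n%:R + u%:R - 1) + u%:R ^+ 2 - u%:R.

(** A window that does not meet the interval has count 0, so only the constant term of the expanded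
    square feels the restriction to [meets]. *)
Lemma varianceE u : (0 < u <= m)%N ->
  variance u = variance_bound u - 2 * cum_missing u.
Proof.
move=> /[dup] u0m /andP[_ um]; rewrite /variance big_mkcond /=.
have dev i : (if meets u i then deviation u i ^+ 2 else 0) =
    window_count u i ^+ 2 - 2 * c * u%:R * window_count u i
    + c ^+ 2 * u%:R ^+ 2 * (meets u i)%:R.
  rewrite /deviation; case: ifPn => /= iu; first by ring.
  rewrite /window_count big1 => [|j _]; first by ring.
  by apply: f0l; move: iu; have := ltn_ord j; rewrite /meets; lia.
under eq_bigr do rewrite dev.
rewrite big_split sumrB /= -!mulr_sumr.
rewrite sum_window_count_sqr // sum_window_count // sum_meets //.
by rewrite /variance_bound; ring.
Qed.

(** * Comparison of the variances at lengths [w], [3 * w] and [4 * w] *)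

Section Compare.
Variable w : nat.
Hypotheses (mE : m = (4 * w)%N) (w0 : (0 < w)%N) (wn : (w < n)%N).

(** The guards [i < T] make [Y] and [Z] vanish when a shifted position leaves the range of
    summation. *)
Let X i : R := if meets (4 * w) i then deviation (4 * w) i ^+ 2 else 0.
Let Y i : R :=
  if meets (3 * w) i && (i < T)%N then deviation (3 * w) i ^+ 2 else 0.
Let Z i : R := if meets w i && (i < T)%N then deviation w i ^+ 2 else 0.

(* A window of length [w] is extended to the right with weight [P], to the
   left with weight [Q]; the weights vary slowly with the position and force
   the extended windows to meet the interval. *)
Let P i := minn (n - w) (T - w - i).
Let Q i := minn (n - w) (i - m).

Let X_ge0 i : 0 <= X i.
Proof. by rewrite /X; case: ifP => // _; rewrite sqr_ge0. Qed.

Let Y_ge0 i : 0 <= Y i.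
Proof. by rewrite /Y; case: ifP => // _; rewrite sqr_ge0. Qed.

Let sqrB_le (x y : R) : (x - y) ^+ 2 <= 2 * (x ^+ 2 + y ^+ 2).
Proof. by have := sqr_ge0 (x + y); rewrite sqrrD sqrrB; lra. Qed.

(** Removing the last [3 * w] places of a window of length [4 * w] leaves its first [w]. A positive
    [P i] forces [i + w < T], so both longer windows are counted. *)
Let extend_right i : (i < T)%N ->
  (P i)%:R * Z i <= (P i)%:R * (2 * (X i + Y (i + w))).
Proof.
move=> iT; case: (posnP (P i)) => [->|P0]; first by rewrite !mul0r.
apply: ler_wpM2l; first exact: ler0n.
rewrite /Z iT andbT; case: ifPn => [iw|_]; last first.
  by rewrite mulr_ge0 // addr_ge0.
have -> : deviation w i = deviation (4 * w) i - deviation (3 * w) (i + w).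
  rewrite /deviation (_ : 4 * w = w + 3 * w)%N ?window_countD ?natrD; last by lia.
  by ring.
rewrite /X /Y !ifT; first exact: sqrB_le.
- by move: P0 iw; rewrite /meets /P; lia.
- by move: P0 iw; rewrite /meets /P; lia.
Qed.

Let extend_left j : (j < T)%N ->
  (Q (j + 3 * w))%:R * Z (j + 3 * w) <= (Q (j + 3 * w))%:R * (2 * (X j + Y j)).
Proof.
move=> jT; case: (posnP (Q (j + 3 * w))) => [->|Q0]; first by rewrite !mul0r.
apply: ler_wpM2l; first exact: ler0n.
rewrite /Z; case: ifPn => [iw|_]; last first.
  by rewrite mulr_ge0 // addr_ge0.
have -> : deviation w (j + 3 * w) = deviation (4 * w) j - deviation (3 * w) j.
  rewrite /deviation (_ : 4 * w = 3 * w + w)%N ?window_countD ?natrD; last by lia.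
  by ring.
rewrite /X /Y !ifT; first exact: sqrB_le.
- by move: Q0 iw; rewrite /meets /Q; lia.
- by move: Q0 iw; rewrite /meets /Q; lia.
Qed.

(** [P] and [Q] add up to [n - w], and a shift of the argument changes each by at most the shift.
    Reindexing the longer windows by their own positions thus gives each a weight of at most
    [n - w + w + 3 * w]. *)
Lemma variance_compare : (n - w)%N%:R * variance w <=
  2 * (n + 3 * w)%N%:R * (variance (4 * w) + variance (3 * w)).
Proof.
have VZ : variance w = \sum_(i < T) Z i.
  by rewrite /variance big_mkcond; apply: eq_bigr => i _; rewrite /Z ltn_ord andbT.
have VX : variance (4 * w) = \sum_(i < T) X i.
  by rewrite /variance big_mkcond.
have VY : variance (3 * w) = \sum_(i < T) Y i.
  by rewrite /variance big_mkcond; apply: eq_bigr => i _; rewrite /Y ltn_ord andbT.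
have PQ i : (P i + Q i = n - w)%N by rewrite /P /Q /T; lia.
have -> : (n - w)%N%:R * variance w =
    \sum_(i < T) (P i)%:R * Z i + \sum_(i < T) (Q i)%:R * Z i.
  rewrite VZ mulr_sumr -big_split /=; apply: eq_bigr => i _.
  by rewrite -mulrDl -natrD PQ.
rewrite -(@sum_shift _ (fun i => (Q i)%:R * Z i) T (3 * w)%N); first last.
- by move=> x xT; rewrite /Z ltnNge xT andbF mulr0.
- by move=> x xw; rewrite /Z /meets ifF ?mulr0 //; lia.
apply: (@le_trans _ _ (\sum_(i < T) (P i)%:R * (2 * (X i + Y (i + w))) +
    \sum_(i < T) (Q (i + 3 * w))%:R * (2 * (X i + Y i)))).
  by apply: lerD; apply: ler_sum => i _; [exact: extend_right|exact: extend_left].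
apply: (@le_trans _ _ (\sum_(i < T) (P i)%:R * (2 * X i) +
    \sum_(i < T) (P (i - w))%:R * (2 * Y i) +
    \sum_(i < T) (Q (i + 3 * w))%:R * (2 * (X i + Y i)))).
  rewrite lerD2r; under eq_bigr do rewrite mulrDr mulrDr.
  rewrite big_split lerD2l /=.
  (* For [x < w] the subtraction truncates to 0, but these terms are only added, and they are
     nonnegative. *)
  pose g x := (P (x - w))%:R * (2 * Y x).
  rewrite (eq_bigr (fun i : 'I_T => g (i + w)%N)); last first.
    by move=> i _; rewrite /g addnK.
  apply: (@sum_shift_le _ g) => x; first by rewrite /g !mulr_ge0.
  by move=> xT; rewrite /g /Y ltnNge xT andbF !mulr0.
rewrite VX VY -!big_split /= mulr_sumr; apply: ler_sum => i _.
have PX : (P i)%:R + (Q (i + 3 * w))%:R <= (n + 3 * w)%N%:R :> R.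
  by rewrite -natrD ler_nat /P /Q /T; lia.
have PY : (P (i - w))%:R + (Q (i + 3 * w))%:R <= (n + 3 * w)%N%:R :> R.
  by rewrite -natrD ler_nat /P /Q /T; lia.
have := ler_wpM2r (X_ge0 i) PX; have := ler_wpM2r (Y_ge0 i) PY.
lra.
Qed.

Lemma variance_bound_compare : (n - w)%N%:R * variance_bound w <=
  2 * (n + 3 * w)%N%:R * (variance_bound (4 * w) + variance_bound (3 * w)).
Proof.
have := variance_compare; rewrite !varianceE; try by lia.
have F3 := cum_missing_ge0 (3 * w); have F1 := cum_missing_ge0 w.
have F4 : 4 * cum_missing w <= cum_missing (4 * w).
  have := cum_missing_superadd w w; have := cum_missing_superadd (w + w) (w + w).
  rewrite (_ : w + w + (w + w) = 4 * w)%N; last by lia.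
  lra.
have N0 : 0 <= (n - w)%N%:R :> R by [].
have N1 : (n - w)%N%:R <= (n + 3 * w)%N%:R :> R by rewrite ler_nat; lia.
set N := (n - w)%N%:R in N0 N1 *; set M := (n + 3 * w)%N%:R in N1 *.
have M0 : 0 <= M by apply: le_trans N1.
have := ler_wpM2r F1 N1; have := ler_wpM2l M0 F4; have := mulr_ge0 M0 F3.
have := mulr_ge0 M0 F1.
lra.
Qed.

End Compare.
End Windows.

(** * Scaling by powers of [n^(1/4)] and numerical estimates *)

Section Asymptotics.
Variable R : realFieldType.

(* With [q = n^(1/4)], [e = 1/q], [u = j s q^3], density [c = 1/q^2] and
   [q^2 + t q] elements, the variance bound of length [u] is [q^5] times: *)
Definition scaled_bound (s e t j : R) : R :=
  j * s * (1 + t * e) - 2 * t * (j * s) ^+ 2 + (j * s) ^+ 3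
  - (j * s) ^+ 2 * e ^+ 3 - j * s * e ^+ 2.

(** At [s = 1/4], [e = 0], [t = 1] the values for [j = 4, 3, 1] are 0, 3/64 and 9/64, and the claim
    reads 6/64 < 9/64; the slack absorbs the perturbations. *)
Lemma scaled_bound_gap (s e t : R) : 0 < e <= 1 / 1000 ->
  1 / 4 - e / 10 <= s <= 1 / 4 -> 499 / 500 <= t ->
  2 * (1 + 3 * s * e) * (scaled_bound s e t 4 + scaled_bound s e t 3)
    < (1 - s * e) * scaled_bound s e t 1.
Proof.
move=> /andP[e0 e1] /andP[s0 s1] t0.
(* The bound is affine in [t]: it is estimated at the least [t], and the excess [d] is treated
   through the slopes. *)
pose G j := scaled_bound s e (499 / 500) j.
have GE j : scaled_bound s e t j =
    G j + (t - 499 / 500) * (j * s * (e - 2 * (j * s))).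
  by rewrite /G /scaled_bound; field.
have s00 : 0 <= s by lra.
(* Tangents at [s = 1/4] and endpoint values bound each monomial, which makes the estimates of [G]
   linear. *)
have ss : (s - 1 / 4) ^+ 2 = s ^+ 2 - s / 2 + 1 / 16 by field.
have p0 : s / 2 - 1 / 16 <= s ^+ 2 by have := sqr_ge0 (s - 1 / 4); lra.
have p1 : s ^+ 2 <= 1 / 16 by have := ler_pM s00 s00 s1 s1; lra.
have r0 : s ^+ 2 / 2 - s / 16 <= s ^+ 3.
  by have := mulr_ge0 s00 (sqr_ge0 (s - 1 / 4)); lra.
have r1 : s ^+ 3 <= 1 / 64 by have := ler_pM s00 (sqr_ge0 s) s1 p1; lra.
have se0 : 0 <= s * e by rewrite mulr_ge0 //; lra.
have se1 : s * e <= 1 / 1000 by have := ler_wpM2r (ltW e0) s1; lra.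
have e20 : 0 <= e ^+ 2 by exact: sqr_ge0.
have e21 : e ^+ 2 <= e by have := ler_wpM2r (ltW e0) e1; lra.
have se20 : 0 <= s * e ^+ 2 by rewrite mulr_ge0 //; lra.
have se21 : s * e ^+ 2 <= e by have := ler_wpM2r e20 s1; lra.
have e30 : 0 <= e ^+ 3 by rewrite exprn_ge0 // ltW.
have e31 : e ^+ 3 <= e by have := ler_wpM2r e20 e1; lra.
have pe0 : 0 <= s ^+ 2 * e ^+ 3 by rewrite mulr_ge0 ?sqr_ge0.
have pe1 : s ^+ 2 * e ^+ 3 <= e by have := ler_wpM2r e30 p1; lra.
have G1 : 69 / 500 <= G 1 by rewrite /G /scaled_bound; lra.
have G43 : G 4 + G 3 <= 63 / 1000 by rewrite /G /scaled_bound; lra.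
rewrite !GE; set d := t - 499 / 500.
have d0 : 0 <= d by rewrite subr_ge0.
(* At [s = 1/4], [e = 0] these slopes are -25/8 and -1/8: raising [t] only widens the gap. *)
have D43 : 4 * s * (e - 2 * (4 * s)) + 3 * s * (e - 2 * (3 * s)) <= - 3 by lra.
have D1 : - (1 / 4) <= 1 * s * (e - 2 * (1 * s)) by lra.
clear s0 s1 t0 e0 e1 GE s00 ss p0 p1 r0 r1 e20 e21 se20 se21 e30 e31 pe0 pe1.
have A1 := ler_wpM2l d0 D43; have A2 := ler_wpM2l d0 D1.
rewrite mulrDr in A1.
set x := G 4 in G43 *; set y := G 3 in G43 *; set z := G 1 in G1 *.
set v4 := d * _ in A1 *; set v3 := d * (3 * s * _) in A1 *.
set v1 := d * _ in A2 *.
have U : x + v4 + (y + v3) <= 63 / 1000 - 3 * d by lra.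
have V : 69 / 500 - d / 4 <= z + v1 by lra.
have U2 : 2 * (1 + 3 * s * e) * (x + v4 + (y + v3))
    <= 2 * (1 + 3 * s * e) * (63 / 1000 - 3 * d).
  by apply: ler_wpM2l => //; lra.
have V2 : (1 - s * e) * (69 / 500 - d / 4) <= (1 - s * e) * (z + v1).
  by apply: ler_wpM2l => //; lra.
apply: le_lt_trans U2 _; apply: lt_le_trans V2.
have := mulr_ge0 se0 d0; lra.
Qed.

End Asymptotics.

Lemma variance_boundE (R : realFieldType) (m n w j : nat) (a : pred nat)
    (q : R) : q != 0 -> n%:R = q ^+ 4 ->
  variance_bound R m n a (q ^- 2) (j * w) = q ^+ 5 *
    scaled_bound R (w%:R / q ^+ 3) q^-1 ((population R m n a - q ^+ 2) / q) j%:R.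
Proof.
move=> q0 nq; rewrite /variance_bound /scaled_bound natrM nq.
set K := population _ _ _ _.
by field.
Qed.

(** Otherwise [t >= 499/500], and [variance_bound_compare], divided by [q^9], contradicts
    [scaled_bound_gap]. The choice of [w] brings [4 * w] close to [n^(3/4)]. *)
Lemma population_lt (R : realFieldType) (n w : nat) (a : pred nat) (q : R) :
  (forall x, a x -> (4 * w <= x < 4 * w + n)%N) ->
  (forall d x y, (0 < d)%N ->
    a x -> a (x + d)%N -> a y -> a (y + d)%N -> x = y) ->
  1000 <= q -> n%:R = q ^+ 4 -> w%:R <= q ^+ 3 / 4 < w.+1%:R ->
  population R (4 * w) n a < q ^+ 2 + 499 / 500 * q.
Proof.
move=> supp dinj q1000 nq /andP[wq qw].
have q0 : 0 < q by lra.
have q00 : q != 0 by rewrite gt_eqF.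
rewrite ltNge; apply/negP => Kq.
set K := population R (4 * w) n a in Kq.
have qi : q^-1 <= 1 / 1000.
  have inv_le (r : R) : 0 < r -> r <= q -> q^-1 <= 1 / r.
    by move=> r0 rq; rewrite div1r lef_pV2 // posrE.
  by apply: inv_le q1000; rewrite ltr0n.
have qi0 : 0 < q^-1 by rewrite invr_gt0.
have q1 : 1 <= q by lra.
have q2 : 1000 * q <= q ^+ 2 by exact: (ler_wpM2r (ltW q0) q1000).
have q3 : q ^+ 2 <= q ^+ 3 by rewrite ler_eXn2l //; lra.
have q4 : q ^+ 3 <= q ^+ 4 by rewrite ler_eXn2l //; lra.
(* Rounding costs at most 1, hence at most [q^2 / 10]; divided by [q^3] this is the tolerance
   [e / 10] on [s]. *)
have wq' : q ^+ 3 / 4 - q ^+ 2 / 10 <= w%:R by rewrite -[w.+1]addn1 natrD in qw; lra.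
have w0 : (0 < w)%N.
  by case: (posnP w) qw => // ->; lra.
have wn : (w < n)%N.
  by rewrite -(ltr_nat R) nq; have := exprn_gt0 3 q0; lra.
have := variance_bound_compare R _ _ _ (q ^- 2) supp dinj w erefl w0 wn.
rewrite (_ : variance_bound R (4 * w) n a (q ^- 2) w =
    variance_bound R (4 * w) n a (q ^- 2) (1 * w)); last by rewrite mul1n.
rewrite !variance_boundE // -/K.
rewrite natrB ?(ltnW wn) // natrD natrM nq.
set s := w%:R / q ^+ 3; set t := (K - q ^+ 2) / q.
have -> : q ^+ 4 - w%:R = q ^+ 4 * (1 - s * q^-1) by rewrite /s; field.
have -> : q ^+ 4 + 3 * w%:R = q ^+ 4 * (1 + 3 * s * q^-1) by rewrite /s; field.
apply/negP; rewrite -ltNge.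
rewrite -mulrDr [ltLHS](_ : _ = q ^+ 4 * q ^+ 5 * (2 * (1 + 3 * s * q^-1)
  * (scaled_bound R s q^-1 t 4 + scaled_bound R s q^-1 t 3))); last by ring.
rewrite [ltRHS]mulrACA ltr_pM2l ?mulr_gt0 ?exprn_gt0 //.
apply: scaled_bound_gap; first by rewrite qi0 qi.
  rewrite /s; apply/andP; split; last by rewrite ler_pdivrMr ?exprn_gt0 //; lra.
  rewrite ler_pdivlMr ?exprn_gt0 //.
  have -> : (1 / 4 - q^-1 / 10) * q ^+ 3 = q ^+ 3 / 4 - q ^+ 2 / 10 by field.
  exact: wq'.
by rewrite /t ler_pdivlMr //; lra.
Qed.

(** * Transfer to Sidon sets of integers *)

Lemma sidon_diff_inj (A : {fset int}) (d x y : nat) :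
  is_sidon [set` A]%classic -> (0 < d)%N ->
  x%:Z \in A -> (x + d)%N%:Z \in A -> y%:Z \in A -> (y + d)%N%:Z \in A -> x = y.
Proof.
move=> sA d0 Ax Axd Ay Ayd.
(* Both pairs have sum [x + y + d]; as [x] differs from [x + d], it must equal [y]. *)
have /(congr1 (fun B : set int => B x%:Z)) :
    [set x%:Z; (y + d)%N%:Z]%classic = [set y%:Z; (x + d)%N%:Z]%classic.
  by apply: sA => //; lia.
by rewrite propeqE => -[+ _] => /(_ (or_introl erefl))[] /=; lia.
Qed.

(** The integer [k] is placed at [m + k - 1]. Without the guard [m <= x], truncated subtraction
    would send every [x < m] to the integer 1. *)
Lemma card_le_population (R : realFieldType) (m n : nat) (A : {fset int}) :
  (A `<=` interval1 n)%fset ->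
  #|` A|%:R <=
  population R m n (fun x => (m <= x)%N && ((x - m).+1%:Z \in A)).
Proof.
move=> An; rewrite /population -natr_sum ler_nat big_split_ord /= big1 ?add0n; last first.
  by move=> i _; rewrite leqNgt ltn_ord.
under eq_bigr do rewrite leq_addr addKn /=.
rewrite (_ : (\sum_(i < n) _)%N = #|[pred i : 'I_n | i.+1%:Z \in A]|); last first.
  by rewrite -sum1_card [RHS]big_mkcond; apply: eq_bigr => i _; rewrite inE; case: ifP.
rewrite cardE -(size_map (fun i : 'I_n => i.+1%:Z)).
apply: uniq_leq_size; first exact: fset_uniq.
move=> x Ax; have := fsubsetP An x Ax; rewrite mem_interval1 => x1n.
have xn : (`|x|%N.-1 < n)%N by lia.
have xE : x = `|x|%N.-1.+1%:Z by lia.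
apply/mapP; exists (Ordinal xn) => //=.
by rewrite mem_enum inE /= -xE.
Qed.

Lemma sidon_card_lt (R : realType) (n : nat) (q : R) (A : {fset int}) :
  (A `<=` interval1 n)%fset -> is_sidon [set` A]%classic ->
  1000 <= q -> n%:R = q ^+ 4 -> #|` A|%:R < q ^+ 2 + 499 / 500 * q.
Proof.
move=> An sA q1000 q4; have q0 : 0 <= q by lra.
have [w qw] : exists w : nat, w%:R <= q ^+ 3 / 4 < w.+1%:R.
  exists (Num.truncn (q ^+ 3 / 4)); apply: truncn_itv.
  by rewrite divr_ge0 ?exprn_ge0.
apply: le_lt_trans (card_le_population R (4 * w) n A An) _.
apply: population_lt => // [x /andP[wx]|d x y d0].
  by move=> /(fsubsetP An); rewrite mem_interval1; lia.
move=> /andP[wx Ax] /andP[_ Axd] /andP[wy Ay] /andP[_ Ayd].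
suff: ((x - 4 * w).+1 = (y - 4 * w).+1)%N by clear -wx wy; lia.
apply: (sidon_diff_inj A d) => //.
  by rewrite addSn addnBAC // in Axd *.
by rewrite addSn addnBAC // in Ayd *.
Qed.

Theorem theorem1p1 (R : realType) :
  exists gamma : R, 2 / 1000 <= gamma /\
  exists n0 : nat, forall n : nat, (n0 < n)%N ->
    (sidon_max n)%:R < n%:R `^ (1 / 2) + n%:R `^ (1 / 4) * (1 - gamma).
Proof.
exists (2 / 1000); split=> //.
(* Beyond [1000^4] one has [n^(1/4) >= 1000], the range where the numerical estimates hold. *)
exists (Num.truncn ((1000 : R) ^+ 4)).+1 => n nn0.
set q := n%:R `^ (1 / 4).
have q4 : n%:R = q ^+ 4.
  rewrite /q -powR_mulrn ?powR_ge0 // -powRrM (_ : 1 / 4 * 4%:R = 1); last by field.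
  by rewrite powRr1.
have -> : n%:R `^ (1 / 2) = q ^+ 2.
  rewrite /q -powR_mulrn ?powR_ge0 // -powRrM (_ : 1 / 4 * 2%:R = 1 / 2) //.
  by field.
have q_ge (r : R) : 0 <= r -> ((Num.truncn (r ^+ 4)).+1 < n)%N -> r <= q.
  move=> r0 rn; rewrite -(@ler_pXn2r _ 4) ?nnegrE ?powR_ge0 // -q4.
  by apply: le_trans (ltW (truncnS_gt _)) _; rewrite ler_nat ltnW.
have q1000 : 1000 <= q by apply: q_ge nn0; rewrite ler0n.
have [A [An sA <-]] := sidon_max_attained n.
rewrite (_ : q * (1 - 2 / 1000) = 499 / 500 * q); last by field.
exact: (sidon_card_lt R n q A An sA q1000 q4).
Qed.
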